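(* Let $G=\langle S\rangle$ be a finite black box group with $|G|<L$, where $L$ is known. There is a randomized algorithm which, for every $\varepsilon$ (with $0<\varepsilon\le 1/2$), and with error probability bounded by any prescribed fixed positive constant, constructs an $\varepsilon$-uniform random variable $X$ on $G$ such that: (a) the cost of constructing $X$ is $O(\log^2|G|+|S|\log|G|)$ group operations; and (b) once $X$ has been constructed, the cost of computing a group element drawn from the distribution of $X$ is $O((\log(1/\varepsilon))\log|G|)$ group operations. Where $|G|$ is not known a priori, $|G|$ can be replaced by $L$ in these asymptotic estimates.
   Context: A black box group is a finite group with an associated oracle, in which group elements are encoded as binary strings of some uniform length; the oracle can multiply two elements, invert an element, and compare an element with the identity. The group is given by a generating set $S$, and cost is measured by the number of group operations (oracle calls). The algorithm may use independent uniform random bits. A random variable $X$ on a finite group $G$ is $\varepsilon$-uniform if $|\Pr(X=g)-1/|G||\le\varepsilon/|G|$ for all $g\in G$. ''Constructing $X$'' means a precomputation (using random choices) producing a list of group elements which determines a sampling procedure; $X$ is the random output of that sampling procedure (over fresh independent random bits), with the precomputed list held fixed. Independent samples from $X$ can then be drawn repeatedly. Constants in $O(\cdot)$ are absolute (depending only on the prescribed error probability), not on $G$, $S$ or $\varepsilon$. *)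

(* Defs.v *)
From HB Require Import structures.
From mathcomp Require Import all_boot all_order all_algebra all_fingroup.
From mathcomp Require Import all_classical all_reals all_analysis.
Set Implicit Arguments.
Unset Strict Implicit.
Unset Printing Implicit Defensive.

Import Order.TTheory GRing.Theory Num.Theory.
Local Open Scope ring_scope.

Definition word (n : nat) := n.-tuple bool.

(* Elements of [G] are encoded by words of uniform length [n].  An element may
   have several codes (hence the oracle for comparison with the identity), and
   a word need not be a code, in which case it decodes to [None] and the
   answers of the oracle on it are arbitrary. *)
Record black_box (n : nat) (gT : finGroupType) (G : {group gT}) := BlackBox {
  decoding : word n -> option gT;
  oracle_mul : word n -> word n -> word n;
  oracle_inv : word n -> word n;
  oracle_is1 : word n -> bool;
  decoding_mem : forall u x, decoding u = Some x -> x \in G;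
  decoding_onto : forall x, x \in G -> exists u, decoding u = Some x;
  oracle_mulP : forall u v x y, decoding u = Some x -> decoding v = Some y ->
    decoding (oracle_mul u v) = Some (x * y)%g;
  oracle_invP : forall u x, decoding u = Some x ->
    decoding (oracle_inv u) = Some (x^-1)%g;
  oracle_is1P : forall u x, decoding u = Some x ->
    oracle_is1 u = (x == 1%g)
}.

(* Adaptive randomized computations with result in [A].  The tree is built
   before any group is fixed: it learns about the group only through the words
   and booleans that the oracle answers.  Computation between the oracle calls
   is free, as the cost counts oracle calls only. *)
Inductive prog (n : nat) (A : Type) : Type :=
| Ret of A
| Flip of bool -> prog n A
| Mul of word n & word n & (word n -> prog n A)
| Inv of word n & (word n -> prog n A)
| IsOne of word n & (bool -> prog n A).

Section Semantics.
Variables (n : nat) (gT : finGroupType) (G : {group gT}) (B : black_box n G).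
Variable A : Type.

(* Number of oracle calls, in the worst case over the random bits. *)
Fixpoint cost (p : prog n A) : nat :=
  match p with
  | Ret _ => 0%N
  | Flip k => maxn (cost (k false)) (cost (k true))
  | Mul u v k => (cost (k (oracle_mul B u v))).+1
  | Inv u k => (cost (k (oracle_inv B u))).+1
  | IsOne u k => (cost (k (oracle_is1 B u))).+1
  end.

(* [E] holds for the result, whatever the random bits are. *)
Fixpoint always (p : prog n A) (E : A -> Prop) : Prop :=
  match p with
  | Ret a => E a
  | Flip k => always (k false) E /\ always (k true) E
  | Mul u v k => always (k (oracle_mul B u v)) E
  | Inv u k => always (k (oracle_inv B u)) E
  | IsOne u k => always (k (oracle_is1 B u)) E
  end.

(* Probability that the result satisfies [E], the bits being independent and
   uniform. *)
Fixpoint Pr (R : realType) (p : prog n A) (E : pred A) : R :=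
  match p with
  | Ret a => (E a)%:R
  | Flip k => (Pr R (k false) E + Pr R (k true) E) / 2
  | Mul u v k => Pr R (k (oracle_mul B u v)) E
  | Inv u k => Pr R (k (oracle_inv B u)) E
  | IsOne u k => Pr R (k (oracle_is1 B u)) E
  end.

End Semantics.

(* [P g] is the probability that the random variable takes the value [g]. *)
Definition eps_uniform (R : realType) (gT : finGroupType) (G : {group gT})
    (eps : R) (P : gT -> R) : bool :=
  [forall g in G, `|P g - 1 / #|G|%:R| <= eps / #|G|%:R].

(* Both procedures are told [eps], the bound [L], the order of the group if it
   is known a priori, and the length of the words.  [construct] maps the list
   of generators to the precomputed list, and [draw] is the sampling procedure
   determined by the latter. *)
Record sampling_algorithm (R : realType) := SamplingAlgorithm {
  construct : forall (eps : R) (L : nat) (order : option nat) (n : nat),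
    seq (word n) -> prog n (seq (word n));
  draw : forall (eps : R) (L : nat) (order : option nat) (n : nat),
    seq (word n) -> prog n (word n)
}.

(* Distribution of the group element computed by [p]. *)
Definition law (R : realType) (n : nat) (gT : finGroupType) (G : {group gT})
    (B : black_box n G) (p : prog n (word n)) (g : gT) : R :=
  Pr B R p (fun w => decoding B w == Some g).

(* Main.v *)
(* Let Z be the law of the random subproduct x_1^e_1 ... x_k^e_k of a list xs
   that starts as the list of generators, and W the law of u v^-1 for u, v
   independent of law Z.  Repeatedly draw x from W and prepend it to xs: the new
   squared l2-norm of Z is (W(1) + W(x)) / 2, where W(1) = |Z|^2 = max W, so it
   drops on average by a constant factor unless W is almost concentrated on the
   set of x with W(x) close to W(1).  Such x almost stabilize Z, hence form a
   subgroup, and since xs generates G no proper subgroup has W-mass above 1/2.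
   As |Z|^2 lies between 1/|G| and 1, after O(log |G|) rounds W is, with high
   probability, within a factor 2 of its maximum everywhere.  Prepending
   elements drawn from such a W to an empty list makes the squared l2-distance
   of its cube to the uniform law shrink by 3/4 on average, so O(log |G|) of
   them give a 1/2-uniform cube, whose length no longer depends on the number
   of generators; a product of t samples of it is 2^-t-uniform. *)

Require Import Defs.
From HB Require Import structures.
From mathcomp Require Import all_boot all_order all_algebra all_fingroup.
From mathcomp Require Import all_classical all_reals all_analysis.
From mathcomp Require Import ring lra.
Set Implicit Arguments.
Unset Strict Implicit.
Unset Printing Implicit Defensive.

Import Order.TTheory GRing.Theory Num.Theory.
Local Open Scope ring_scope.

(** * Correlations and flatness *)

Section Correlation.
Variables (R : realType) (gT : finGroupType).
Implicit Types (Z q : gT -> R) (x y g h : gT).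

(** For a distribution [Z], this is the law of [u * v^-1] with [u], [v] independent of law [Z]. It
    is also applied to signed functions, as an autocorrelation. *)
Definition corr Z x : R := \sum_h Z (x * h)%g * Z h.

Definition distribution Z : Prop := (forall g, 0 <= Z g) /\ \sum_g Z g = 1.

Lemma sum_mulgl Z x : \sum_g Z (x * g)%g = \sum_g Z g.
Proof. by rewrite [RHS](reindex_inj (mulgI x)). Qed.

Lemma sum_mulgr Z x : \sum_g Z (g * x)%g = \sum_g Z g.
Proof. by rewrite [RHS](reindex_inj (mulIg x)). Qed.

Lemma corr1 Z : corr Z 1%g = \sum_g Z g ^+ 2.
Proof. by apply: eq_bigr => g _; rewrite mul1g expr2. Qed.

Lemma corr_ge0 Z x : distribution Z -> 0 <= corr Z x.
Proof. by case=> Z0 _; apply: sumr_ge0 => h _; rewrite mulr_ge0. Qed.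

Lemma sum_corr Z : \sum_x corr Z x = (\sum_g Z g) ^+ 2.
Proof.
rewrite /corr exchange_big /= expr2 mulr_sumr; apply: eq_bigr => h _.
by rewrite -mulr_suml sum_mulgr.
Qed.

Lemma corrV Z x : corr Z x^-1%g = corr Z x.
Proof.
rewrite /corr (reindex_inj (mulgI x)).
by apply: eq_bigr => h _; rewrite mulKg mulrC.
Qed.

Lemma sum_sqr_diff Z x :
  \sum_h (Z (x * h)%g - Z h) ^+ 2 = 2 * (corr Z 1%g - corr Z x).
Proof.
transitivity (\sum_h (Z (x * h)%g ^+ 2 + Z h ^+ 2 - 2 * (Z (x * h)%g * Z h))).
  by apply: eq_bigr => h _; ring.
rewrite big_split big_split /= (sum_mulgl (fun h => Z h ^+ 2)) sumrN -mulr_sumr.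
rewrite corr1 -/(corr Z x); ring.
Qed.

Lemma corr_le1 Z x : corr Z x <= corr Z 1%g.
Proof.
have : 0 <= \sum_h (Z (x * h)%g - Z h) ^+ 2.
  by apply: sumr_ge0 => h _; apply: sqr_ge0.
rewrite sum_sqr_diff; lra.
Qed.

(* [corr Z 1 - corr Z x] is half the squared distance between [Z] and its
   translate by [x]. *)
Lemma corr_defectM Z x y :
  corr Z 1%g - corr Z (x * y)%g <=
  2 * (corr Z 1%g - corr Z x) + 2 * (corr Z 1%g - corr Z y).
Proof.
suff : 2 * (corr Z 1%g - corr Z (x * y)%g) <=
    2 * (2 * (corr Z 1%g - corr Z x)) + 2 * (2 * (corr Z 1%g - corr Z y)) by lra.
rewrite -!sum_sqr_diff -(sum_mulgl (fun h => (Z (x * h)%g - Z h) ^+ 2) y).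
rewrite !mulr_sumr -big_split /=; apply: ler_sum => h _; rewrite -mulgA.
have := sqr_ge0 ((Z (x * (y * h))%g - Z (y * h)%g) - (Z (y * h)%g - Z h)).
nra.
Qed.

(** The [#|gT|] values of [corr Z] sum to 1, and the one at 1 is the largest. *)
Lemma card_corr1_ge1 Z : distribution Z -> 1 <= #|gT|%:R * corr Z 1%g.
Proof.
move=> [Z0 Z1].
rewrite mulr_natl -sumr_const -(expr1n _ 2) -Z1 -sum_corr.
by apply: ler_sum => x _; apply: corr_le1.
Qed.

Lemma corr1_gt0 Z : distribution Z -> 0 < corr Z 1%g.
Proof.
move=> dZ; rewrite -(@pmulr_rgt0 _ #|gT|%:R).
  exact: lt_le_trans ltr01 (card_corr1_ge1 dZ).
by rewrite ltr0n; apply/card_gt0P; exists 1%g.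
Qed.

Definition flat Z : bool :=
  [forall x, corr Z 1%g - corr Z x <= corr Z 1%g / 2].

(* The almost-stabilizers of [Z] form a subgroup: they are stable under
   products up to a loss in the tolerance, and counting shows that enlarging
   the tolerance creates no new ones. *)
Lemma flat_or_contraction Z : distribution Z ->
  (forall H : {group gT}, H != [set: gT] :> {set gT} ->
     \sum_(x in H) corr Z x <= 1 / 2) ->
  ~~ flat Z -> \sum_x corr Z x ^+ 2 <= (1 - 1 / 1000) * corr Z 1%g.
Proof.
move=> dZ escape nflat; rewrite leNgt; apply/negP => big.
have w0 := corr1_gt0 dZ.
have W0 x := corr_ge0 x dZ.
have Wle x := corr_le1 Z x.
have W1 : \sum_x corr Z x = 1 by rewrite sum_corr dZ.2 expr1n.
set w := corr Z 1%g in big w0 Wle.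
pose near (c : R) := [set x | w - corr Z x <= c * w].
have nearE c x : (x \in near c) = (w - corr Z x <= c * w) by rewrite inE.
pose A := near (1 / 100).
(* Markov: under the law [corr Z] the mean of [w - corr Z x] is below [w / 1000], whereas its values
   off [A] exceed [w / 100]. *)
have massA : 9 / 10 < \sum_(x in A) corr Z x.
  have split1 : \sum_(x in A) corr Z x + \sum_(x | x \notin A) corr Z x = 1.
    by rewrite -W1 [RHS](bigID (mem A)).
  have : \sum_(x | x \notin A) corr Z x * (1 / 100 * w) < 1 / 1000 * w.
    apply: (@le_lt_trans _ _ (\sum_x corr Z x * (w - corr Z x))).
      rewrite [leRHS](bigID (mem A)) /= -[leLHS]add0r; apply: lerD.
        by apply: sumr_ge0 => x _; rewrite mulr_ge0 // subr_ge0.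
      apply: ler_sum => x; rewrite nearE -ltNge => /ltW ?.
      exact: ler_wpM2l.
    have -> : \sum_x corr Z x * (w - corr Z x) = w - \sum_x corr Z x ^+ 2.
      under eq_bigr => x _ do rewrite mulrBr -expr2.
      by rewrite big_split /= sumrN -mulr_suml W1 mul1r.
    lra.
  rewrite -mulr_suml; nra.
have cardA : 9 / 10 < #|A|%:R * w.
  apply: lt_le_trans massA _; rewrite mulr_natl -sumr_const.
  by apply: ler_sum.
have card_near (c : R) : #|near c|%:R * ((1 - c) * w) <= 1.
  rewrite -[leRHS]W1 mulr_natl -sumr_const [leRHS](bigID (mem (near c))) /=.
  rewrite -[leLHS]addr0; apply: lerD; last exact: sumr_ge0.
  by apply: ler_sum => x; rewrite nearE; lra.
(* If [A] and [z * A] were disjoint, their union would lie in [near (34 / 100)], as 2 * 16 + 2 * 1 =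
   34, and have more than [1.8 / w] elements, while [card_near] allows at most [1 / (0.66 * w)]. So
   [z = b * a^-1] with [a], [b] in [A], of defect at most (2 + 2) / 100. *)
have near_absorb z : z \in near (16 / 100) -> z \in near (4 / 100).
  rewrite nearE => dz.
  have [disj|] := boolP [disjoint A & [set (z * a)%g | a in A]].
    have sub : A :|: [set (z * a)%g | a in A] \subset near (34 / 100).
      apply/fintype.subsetP => b; rewrite inE => /orP[|/imsetP[a]].
        by rewrite !nearE; nra.
      rewrite !nearE => da ->; have := corr_defectM Z z a; rewrite -/w; lra.
    have := subset_leq_card sub.
    rewrite cardsU disjoint_setI0 // cards0 subn0 card_imset; last exact: mulgI.
    rewrite -(ler_nat R) natrD => le_card.
    have := card_near (34 / 100); nra.
  rewrite -finset.setI_eq0 => /set0Pn[b]; rewrite inE => /andP[+ /imsetP[a aA b_eq]].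
  have -> : z = (b * a^-1)%g by rewrite b_eq mulgK.
  move: aA; rewrite !nearE => da db; have := corr_defectM Z b a^-1%g.
  rewrite corrV -/w; lra.
(* A product of two elements lands in [near (16 / 100)], as 2 * 4 + 2 * 4 = 16, and is then
   absorbed. *)
have gH : group_set (near (4 / 100)).
  apply/group_setP; split; first by rewrite nearE subrr; nra.
  move=> x y; rewrite !nearE => dx dy; rewrite -nearE; apply: near_absorb.
  by rewrite nearE; have := corr_defectM Z x y; rewrite -/w; lra.
(* If the subgroup is everything, [Z] is flat; otherwise its mass is at most 1/2 although it
   contains [A]. *)
have [HT|/escape /= massH] := eqVneq (Group gH : {set gT}) [set: gT].
  case/negP: nflat; apply/forallP => x.
  have : x \in near (4 / 100) by rewrite [near _]HT inE.
  rewrite nearE -/w; lra.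
suff : \sum_(x in A) corr Z x <= \sum_(x in near (4 / 100)) corr Z x by lra.
rewrite [leRHS](bigID (mem A)) /= -[leLHS]addr0; apply: lerD; last exact: sumr_ge0.
rewrite le_eqVlt; apply/orP; left; apply/eqP/eq_bigl => x.
by rewrite !nearE andb_idl //; nra.
Qed.

End Correlation.

(** * Random cubes *)

(* Locked, lest unification unfold the unary numeral. *)
Definition rate (R : realType) : R := locked (1 - 1 / 2000).

(** The lower bound lets the second phase, which contracts by 3/4, be measured by the same rate. *)
Lemma rate_bounds (R : realType) : 3 / 4 <= rate R < 1.
Proof. by rewrite /rate -lock; apply/andP; split; lra. Qed.

Lemma rate_ge0 (R : realType) : 0 <= rate R.
Proof. by have := rate_bounds R; lra. Qed.

Section Cube.
Variables (R : realType) (gT : finGroupType).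
Implicit Types (Z q : gT -> R) (x y g h a : gT) (xs ys : seq gT).

(** The law of [x^e * z] for a uniform bit [e] and an independent [z] of law [Z]. *)
Definition half_shift Z x : gT -> R := fun g => (Z g + Z (x^-1 * g)%g) / 2.

(* The random cube: the distribution of [x_1^e_1 * ... * x_k^e_k] for
   independent uniform bits [e_i]. *)
Fixpoint cube xs : gT -> R :=
  if xs is x :: xs' then half_shift (cube xs') x else fun g => (g == 1%g)%:R.

Lemma cube_distribution xs : distribution (cube xs).
Proof.
elim: xs => [|x xs [Z0 Z1]] /=; split.
- by move=> g; rewrite ler0n.
- rewrite (bigD1 1%g) //= eqxx big1 ?addr0 // => g /negbTE ->.
  by [].
- by move=> g; rewrite divr_ge0 // addr_ge0.
- rewrite -mulr_suml big_split /= sum_mulgl Z1; lra.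
Qed.

Lemma cube_cat xs ys g :
  cube (xs ++ ys) g = \sum_h cube xs h * cube ys (h^-1 * g)%g.
Proof.
elim: xs g => [|x xs IH] g /=.
  rewrite (bigD1 1%g) //= eqxx mul1r invg1 mul1g big1 ?addr0 // => h /negbTE ->.
  by rewrite mul0r.
rewrite /half_shift !IH (reindex_inj (mulgI x)) /= -big_split /= mulr_suml.
rewrite [RHS](eq_bigr (fun h => (cube xs h * cube ys (h^-1 * g)%g +
  cube xs (x^-1 * h)%g * cube ys (h^-1 * g)%g) / 2)); last by move=> h _; ring.
rewrite -!mulr_suml !big_split /=; congr ((_ + _) / _).
  by rewrite [RHS](reindex_inj (mulgI x)).
rewrite [RHS](reindex_inj (mulgI x)); apply: eq_bigr => h _.
by rewrite mulKg invMg mulgA.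
Qed.

(** Phrased through subgroups because it serves only to exclude that a proper subgroup contains
    [xs]. *)
Definition generating xs : Prop :=
  forall H : {group gT}, all (mem H) xs -> H = [set: gT] :> {set gT}.

Lemma generating_cons x xs : generating xs -> generating (x :: xs).
Proof. by move=> gen H /= /andP[_ /gen]. Qed.

(* Condition on all bits but that of the first [x_i] outside [H]: at most one
   value of this bit leads into [H * a]. *)
Lemma cube_coset xs (H : {group gT}) a :
  ~~ all (mem H) xs -> \sum_(h in H) cube xs (h * a)%g <= 1 / 2.
Proof.
elim: xs => [//|x xs IH] /=; rewrite /half_shift -mulr_suml big_split /=.
(* For [x] in [H] the shift permutes [H], so both halves are the same coset mass for [xs]. Otherwise
   [H * a] and [x^-1 * H * a] are disjoint, so their masses add up to at most 1. *)
have [xH /= /IH le_half|xnH _] := boolP (x \in H).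
  rewrite [X in _ + X](reindex_inj (mulgI x)) /=.
  rewrite [X in _ + X](eq_big (mem H) (fun h => cube xs (h * a)%g)).
  - lra.
  - by move=> h /=; rewrite groupMl.
  - by move=> h _; rewrite -mulgA mulKg.
have [Z0 Z1] := cube_distribution xs.
suff : \sum_(h in H) cube xs (h * a)%g +
    \sum_(h in H) cube xs (x^-1 * (h * a))%g <= 1 by lra.
rewrite [X in _ + X](reindex_inj (mulgI x)) /=.
rewrite [X in _ + X](eq_bigr (fun h => cube xs (h * a)%g)); last first.
  by move=> h _; rewrite -mulgA mulKg.
rewrite -[leRHS]Z1 -[leRHS](sum_mulgr _ a) [leRHS](bigID (mem H)) /=.
apply: lerD => //; rewrite [leRHS](bigID (fun h => (x * h)%g \in H)) /=.
rewrite -[leLHS]addr0; apply: lerD; last exact: sumr_ge0.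
rewrite le_eqVlt; apply/orP; left; apply/eqP/eq_bigl => h.
rewrite andb_idl // => xhH; apply: contra xnH => hH.
by rewrite -(groupMr x hH).
Qed.

(** For fixed [v], the product [u * v^-1] lies in [H] exactly when [u] lies in the coset [H * v],
    whose mass is at most 1/2. *)
Lemma cube_escape xs (H : {group gT}) : generating xs ->
  H != [set: gT] :> {set gT} -> \sum_(x in H) corr (cube xs) x <= 1 / 2.
Proof.
move=> gen nHT; rewrite /corr exchange_big /=.
have [Z0 Z1] := cube_distribution xs.
rewrite -[leRHS]mulr1 -[X in _ * X]Z1 mulr_sumr; apply: ler_sum => h _.
rewrite -mulr_suml; apply: ler_wpM2r => //; apply: cube_coset.
by apply: contra nHT => /gen ->.
Qed.

Lemma corr1_half_shift Z x :
  corr (half_shift Z x) 1%g = (corr Z 1%g + corr Z x) / 2.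
Proof.
rewrite !corr1 (eq_bigr (fun g => (Z g ^+ 2 + Z (x^-1 * g)%g ^+ 2 +
  2 * (Z (x^-1 * g)%g * Z g)) / 4)); last by move=> g _; rewrite /half_shift; field.
rewrite -mulr_suml 2!big_split /= -mulr_sumr -/(corr Z x^-1%g) corrV.
by rewrite (sum_mulgl (fun g => Z g ^+ 2)); field.
Qed.

(** The new quotient is [x^e * w * x^-f] with [w] of law [corr Z] and independent bits [e], [f]; the
    four terms are the choices of these bits. *)
Lemma corr_half_shift Z x y : corr (half_shift Z x) y =
  (corr Z y + corr Z (x^-1 * y)%g + corr Z (y * x)%g + corr Z (x^-1 * y * x)%g) / 4.
Proof.
have shift z : \sum_h Z (z * h)%g * Z (x^-1 * h)%g = corr Z (z * x)%g.
  rewrite (reindex_inj (mulgI x)) /=; apply: eq_bigr => h _.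
  by rewrite mulKg mulgA.
rewrite -!shift /corr -!big_split /= mulr_suml; apply: eq_bigr => h _.
by rewrite /half_shift !mulgA; field.
Qed.

(** Each of the four averaged terms is at least [corr Z 1 / 2], and the maximum does not grow. Hence
    flatness, once reached, survives the remaining rounds. *)
Lemma flat_half_shift Z x : flat Z -> flat (half_shift Z x).
Proof.
move/forallP => fl; apply/forallP => y.
rewrite corr1_half_shift corr_half_shift.
have := corr_le1 Z x.
have := fl y; have := fl (x^-1 * y)%g; have := fl (y * x)%g.
have := fl (x^-1 * y * x)%g; lra.
Qed.

(** Setting the squared norm to 0 on flat states makes the contraction valid in every round, without
    a stopping rule. *)
Definition potential xs : R := (~~ flat (cube xs))%:R * corr (cube xs) 1%g.

Lemma potential_le1 xs : potential xs <= 1.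
Proof.
have dZ := cube_distribution xs; have W0 x := corr_ge0 x dZ.
rewrite /potential; apply: le_trans (_ : corr (cube xs) 1%g <= 1).
  by case: (flat _); rewrite ?mul0r ?mul1r.
have -> : 1 = \sum_x corr (cube xs) x by rewrite sum_corr dZ.2 expr1n.
by rewrite (bigD1 1%g) //= lerDl sumr_ge0.
Qed.

Lemma potential_contract xs : generating xs ->
  \sum_x corr (cube xs) x * potential (x :: xs) <=
  rate R * potential xs.
Proof.
move=> gen; have dZ := cube_distribution xs.
rewrite {2}/potential; have [fl|nfl] := boolP (flat (cube xs)).
  rewrite mul0r mulr0 big1 // => x _.
  by rewrite /potential /= flat_half_shift // mul0r mulr0.
have := flat_or_contraction dZ (fun H => @cube_escape xs H gen) nfl.
have W1 : \sum_x corr (cube xs) x = 1 by rewrite sum_corr dZ.2 expr1n.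
move=> contr; rewrite mul1r.
apply: (@le_trans _ _ (\sum_x corr (cube xs) x *
    ((corr (cube xs) 1%g + corr (cube xs) x) / 2))).
  apply: ler_sum => x _; apply: ler_wpM2l; first exact: corr_ge0.
  have := corr_ge0 1%g (cube_distribution (x :: xs)).
  rewrite /potential /= corr1_half_shift.
  by case: (flat _); rewrite ?mul0r ?mul1r.
(* With [w = corr (cube xs) 1] the average is [w / 2] plus half the sum of squares, at most
   [w / 2 + (1 - 1 / 1000) * w / 2]; hence the 1/2000 in [rate]. *)
rewrite (eq_bigr (fun x => corr (cube xs) x * (corr (cube xs) 1%g / 2) +
  corr (cube xs) x ^+ 2 / 2)); last by move=> x _; field.
rewrite big_split /= -!mulr_suml W1 /rate -lock; lra.
Qed.

(** Markov's inequality in indicator form: the squared norm is at least [1 / #|gT|]. *)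
Lemma not_flat_le_potential xs :
  (~~ flat (cube xs))%:R <= #|gT|%:R * potential xs.
Proof.
rewrite /potential mulrCA ler_peMr ?ler0n //.
exact: card_corr1_ge1 (cube_distribution xs).
Qed.

(** * Distance of a cube to the uniform law *)

Definition excess ys g : R := cube ys g - 1 / #|gT|%:R.

Definition imbalance ys : R := \sum_g excess ys g ^+ 2.

Lemma card_gt0R : 0 < #|gT|%:R :> R.
Proof. by rewrite ltr0n; apply/card_gt0P; exists 1%g. Qed.

Lemma sum_inv_card : \sum_(g : gT) 1 / #|gT|%:R = 1 :> R.
Proof.
rewrite sumr_const -[LHS]mulr_natl mulrCA mulfV ?mulr1 //.
exact: lt0r_neq0 card_gt0R.
Qed.

Lemma sum_excess ys : \sum_g excess ys g = 0.
Proof.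
by rewrite big_split /= (cube_distribution ys).2 sumrN sum_inv_card subrr.
Qed.

Lemma imbalance_ge0 ys : 0 <= imbalance ys.
Proof. by apply: sumr_ge0 => g _; apply: sqr_ge0. Qed.

Lemma imbalance_nil : imbalance [::] <= 1.
Proof.
have N0 := card_gt0R.
have N1 : 1 / #|gT|%:R <= 1 :> R.
  by rewrite ler_pdivrMr // mul1r ler1n -(ltr0n R).
have p0 : 0 <= 1 / #|gT|%:R :> R by rewrite divr_ge0 // ltW.
(* Holds pointwise because [cube [::]] takes only the values 0 and 1; the subtracted term then sums
   to 0. *)
apply: (@le_trans _ _ (\sum_g (cube [::] g - (1 / #|gT|%:R) * excess [::] g) )).
  apply: ler_sum => g _; rewrite /excess /=.
  case: (g == 1%g); rewrite /=; nra.
rewrite big_split /= sumrN -mulr_sumr sum_excess mulr0 subr0.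
by rewrite (cube_distribution [::]).2.
Qed.

(** The uniform law is fixed by shifts, so the norm identity for [half_shift] applies to the
    excess. *)
Lemma excess_cons x ys : excess (x :: ys) =1 half_shift (excess ys) x.
Proof.
move=> g; rewrite /excess /= /half_shift; field.
exact: lt0r_neq0 card_gt0R.
Qed.

(* Uniform sampling would halve the imbalance on average; a flat distribution
   exceeds a multiple of the uniform one by a total mass of at most 1/2. *)
Lemma imbalance_contract xs ys : flat (cube xs) ->
  \sum_x corr (cube xs) x * imbalance (x :: ys) <= 3 / 4 * imbalance ys.
Proof.
move=> /forallP fl; have dZ := cube_distribution xs.
have W1 : \sum_x corr (cube xs) x = 1 by rewrite sum_corr dZ.2 expr1n.
have Nw := card_corr1_ge1 dZ.
set W := corr (cube xs) in fl W1 Nw *; set q := excess ys.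
have D1 : imbalance ys = corr q 1%g by rewrite corr1.
have step x : imbalance (x :: ys) = (corr q 1%g + corr q x) / 2.
  by rewrite -corr1_half_shift corr1; apply: eq_bigr => g _; rewrite excess_cons.
have C0 : \sum_x corr q x = 0 by rewrite sum_corr sum_excess expr0n.
have D0 : 0 <= corr q 1%g by rewrite -D1 imbalance_ge0.
rewrite (eq_bigr (fun x => W x * (corr q 1%g / 2) + W x * corr q x / 2));
  last by move=> x _; rewrite step; field.
rewrite big_split /= -!mulr_suml W1 D1.
suff : \sum_x W x * corr q x <= 1 / 2 * corr q 1%g by lra.
(* As [corr q] sums to 0, a constant may be subtracted from the weights. By flatness they stay
   nonnegative, so [corr q x] can be replaced by its maximum. *)
have -> : \sum_x W x * corr q x = \sum_x (W x - W 1%g / 2) * corr q x.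
  under [RHS]eq_bigr => x _ do rewrite mulrBl.
  by rewrite big_split /= sumrN -mulr_sumr C0 mulr0 subr0.
apply: (@le_trans _ _ (\sum_x (W x - W 1%g / 2) * corr q 1%g)).
  apply: ler_sum => x _; apply: ler_wpM2l; last exact: corr_le1.
  have := fl x; lra.
(* The remaining weight is [1 - #|gT| * W 1 / 2], at most 1/2 by [Nw]. *)
rewrite -mulr_suml big_split /= W1 sumr_const -[X in _ + X]mulr_natl.
apply: ler_wpM2r => //; rewrite [X in X * _](_ : _ = #|gT|%:R) //; lra.
Qed.

Lemma sqr_excess_le_imbalance ys g : excess ys g ^+ 2 <= imbalance ys.
Proof.
rewrite /imbalance (bigD1 g) //= lerDl; apply: sumr_ge0 => h _; exact: sqr_ge0.
Qed.

Definition cube_uniform (eps : R) ys : Prop :=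
  forall g, `|excess ys g| <= eps / #|gT|%:R.

(** Concatenation convolves the cubes, and the excesses too, since the cross terms with the uniform
    law vanish. *)
Lemma cube_uniform_cat (c d : R) xs ys :
  cube_uniform c xs -> cube_uniform d ys -> cube_uniform (c * d) (xs ++ ys).
Proof.
move=> uc ud g.
have sum_ys : \sum_h excess ys (h^-1 * g)%g = 0.
  rewrite (reindex_inj invg_inj) /=; under eq_bigr do rewrite invgK.
  by rewrite sum_mulgr sum_excess.
have -> : excess (xs ++ ys) g = \sum_h excess xs h * excess ys (h^-1 * g)%g.
  transitivity (\sum_h (cube xs h * cube ys (h^-1 * g)%g -
      cube xs h * (1 / #|gT|%:R) - 1 / #|gT|%:R * excess ys (h^-1 * g)%g)).
    rewrite 2!big_split /= !sumrN -mulr_suml -mulr_sumr sum_ys mulr0 subr0.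
    by rewrite (cube_distribution xs).2 mul1r -cube_cat.
  by apply: eq_bigr => h _; rewrite /excess; ring.
apply: le_trans (ler_norm_sum _ _ _) _.
apply: (@le_trans _ _ (\sum_(h : gT) (c / #|gT|%:R) * (d / #|gT|%:R))).
  by apply: ler_sum => h _; rewrite normrM ler_pM.
rewrite sumr_const -[leLHS]mulr_natl [X in X * _](_ : _ = #|gT|%:R) //.
rewrite le_eqVlt; apply/orP; left; apply/eqP; field.
exact: lt0r_neq0 card_gt0R.
Qed.

(** At least one copy is required: the empty cube is concentrated at 1, which is not 1-uniform on
    more than two elements. *)
Lemma cube_uniform_rep (c : R) t ys : cube_uniform c ys ->
  cube_uniform (c ^+ t.+1) (flatten (nseq t.+1 ys)).
Proof.
move=> uys; elim: t => [|t IH]; first by rewrite /= cats0.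
by rewrite exprS; apply: cube_uniform_cat IH.
Qed.

Lemma imbalance_small (c : R) ys : 0 <= c ->
  imbalance ys <= (c / #|gT|%:R) ^+ 2 -> cube_uniform c ys.
Proof.
move=> c0 small g.
have N0 := card_gt0R.
rewrite -(@ler_pXn2r _ 2) ?nnegrE ?normr_ge0 ?divr_ge0 ?(ltW N0) //.
rewrite real_normK ?num_real //.
exact: le_trans (sqr_excess_le_imbalance ys g) small.
Qed.

End Cube.

(** * Programs *)

Fixpoint bind (n : nat) (A A' : Type) (p : prog n A) (f : A -> prog n A') :
    prog n A' :=
  match p with
  | Ret a => f a
  | Flip k => Flip (fun b => bind (k b) f)
  | Mul u v k => Mul u v (fun w => bind (k w) f)
  | Defs.Inv u k => Defs.Inv u (fun w => bind (k w) f)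
  | IsOne u k => IsOne u (fun b => bind (k b) f)
  end.

Fixpoint repeat (n : nat) (A : Type) (k : nat) (step : A -> prog n A) (s : A) :
    prog n A :=
  if k is k'.+1 then bind (step s) (repeat k' step) else Ret n s.

Section ProgramSemantics.
Variables (R : realType) (n : nat) (gT : finGroupType) (G : {group gT}).
Variable B : black_box n G.

Fixpoint expect (A : Type) (p : prog n A) (f : A -> R) : R :=
  match p with
  | Ret a => f a
  | Flip k => (expect (k false) f + expect (k true) f) / 2
  | Mul u v k => expect (k (oracle_mul B u v)) f
  | Defs.Inv u k => expect (k (oracle_inv B u)) f
  | IsOne u k => expect (k (oracle_is1 B u)) f
  end.

Section Bind.
Variables A A' : Type.
Implicit Types (p : prog n A) (h : A -> prog n A').

Lemma Pr_expect p (E : pred A) : Pr B R p E = expect p (fun a => (E a)%:R).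
Proof. by elim: p => [a|k IH|u v k IH|u k IH|u k IH] //=; rewrite !IH. Qed.

Lemma expect_bind p h (f : A' -> R) :
  expect (bind p h) f = expect p (fun a => expect (h a) f).
Proof. by elim: p => [a|k IH|u v k IH|u k IH|u k IH] //=; rewrite !IH. Qed.

Lemma always_bind p h (E : A' -> Prop) :
  always B (bind p h) E <-> always B p (fun a => always B (h a) E).
Proof. by elim: p => [a|k IH|u v k IH|u k IH|u k IH] //=; rewrite !IH. Qed.

Lemma always_impl p (E F : A -> Prop) :
  (forall a, E a -> F a) -> always B p E -> always B p F.
Proof.
move=> EF; elim: p => [/= a /EF|k IH /= [/IH ? /IH]|u v k IH /= /IH|
  u k IH /= /IH|u k IH /= /IH] //.
Qed.

(** Comparing only on reachable results lets invariants be used under the expectation. *)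
Lemma expect_le p (f g : A -> R) :
  always B p (fun a => f a <= g a) -> expect p f <= expect p g.
Proof.
elim: p => [a|k IH /= [/IH ? /IH ?]|u v k IH /= /IH|u k IH /= /IH|u k IH /= /IH] //.
by rewrite ler_pM2r ?invr_gt0 ?ltr0n // lerD.
Qed.

Lemma eq_expect p (f g : A -> R) :
  always B p (fun a => f a = g a) -> expect p f = expect p g.
Proof.
by elim: p => [a|k IH /= [/IH -> /IH ->]|u v k IH /= /IH|u k IH /= /IH|u k IH /= /IH].
Qed.

Lemma expectZ p c (f : A -> R) : expect p (fun a => c * f a) = c * expect p f.
Proof.
by elim: p => [a|k IH|u v k IH|u k IH|u k IH] //=; rewrite !IH //; ring.
Qed.

Lemma expectDr p c (f : A -> R) : expect p (fun a => f a + c) = expect p f + c.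
Proof.
by elim: p => [a|k IH|u v k IH|u k IH|u k IH] //=; rewrite !IH //; field.
Qed.

Lemma expect_cst p c : expect p (fun=> c) = c.
Proof.
by elim: p => [a|k IH|u v k IH|u k IH|u k IH] //=; rewrite !IH; field.
Qed.

Lemma cost_bind p h c : always B p (fun a => (cost B (h a) <= c)%N) ->
  (cost B (bind p h) <= cost B p + c)%N.
Proof.
elim: p => [a|k IH /= [/IH le0 /IH le1]|u v k IH /= /IH|u k IH /= /IH|u k IH /= /IH] //.
by rewrite addn_maxl geq_max !leq_max le0 le1 orbT.
Qed.

End Bind.

Section Repeat.
Variables (A : Type) (step : A -> prog n A).
(* [I i s] holds of the state [s] when [i] iterations remain. *)
Variable I : nat -> A -> Prop.
Hypothesis stepI : forall i s, I i.+1 s -> always B (step s) (I i).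

Lemma always_repeat k s : I k s -> always B (repeat k step s) (I 0).
Proof.
elim: k s => //= k IH s /stepI Is; apply/always_bind.
exact: always_impl Is.
Qed.

Lemma cost_repeat c k s : (forall i s', I i.+1 s' -> (cost B (step s') <= c)%N) ->
  I k s -> (cost B (repeat k step s) <= k * c)%N.
Proof.
move=> le_c; elim: k s => //= k IH s Is; rewrite mulSn.
apply: leq_trans (cost_bind (c := k * c) _) _; last by rewrite leq_add2r (le_c k).
exact: always_impl (stepI Is).
Qed.

Lemma expect_repeat (q : R) (f : A -> R) k s : 0 <= q ->
  (forall i s', I i.+1 s' -> expect (step s') f <= q * f s') ->
  I k s -> expect (repeat k step s) f <= q ^+ k * f s.
Proof.
move=> q0 le_q; elim: k s => [|k IH] s Is /=; first by rewrite expr0 mul1r.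
rewrite expect_bind; apply: (@le_trans _ _ (expect (step s) (fun a => q ^+ k * f a))).
  by apply: expect_le; apply: always_impl (stepI Is).
rewrite expectZ exprSr -mulrA ler_wpM2l ?exprn_ge0 //; exact: le_q Is.
Qed.

End Repeat.
End ProgramSemantics.

(** * Random subproducts and the two sampling phases *)

Fixpoint subproduct (n : nat) (xs : seq (word n)) (u : word n) :
    prog n (word n) :=
  if xs is x :: xs' then
    Flip (fun b => if b then Mul u x (subproduct xs') else subproduct xs' u)
  else Ret n u.

Definition sample (n : nat) (e : word n) (xs : seq (word n)) :
    prog n (word n) :=
  bind (subproduct xs e) (fun u => bind (subproduct xs e) (fun v =>
    Defs.Inv v (fun v' => Mul u v' (@Ret n _)))).

Definition extend (n : nat) (e : word n) (xs l : seq (word n)) :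
    prog n (seq (word n)) :=
  bind (sample e xs) (fun x => Ret n (x :: l)).

(** A code of the identity is obtained as [u * u^-1] and kept at the head for later draws. The first
    phase samples from the list it extends; the second samples from the fixed result [xs] and starts
    from an empty list. *)
Definition build (n k : nat) (gens : seq (word n)) : prog n (seq (word n)) :=
  if gens is u :: _ then
    Defs.Inv u (fun v => Mul u v (fun e =>
      bind (repeat k (fun xs => extend e xs xs) gens) (fun xs =>
        bind (repeat k (extend e xs) [::]) (fun ys => Ret n (e :: ys)))))
  else Ret n [::].

Definition no_word (n : nat) : word n := nseq_tuple n false.

(** A subproduct of [t] concatenated copies of [ys] is a product of [t] independent samples of its
    cube. *)
Definition draw_cubes (n t : nat) (l : seq (word n)) : prog n (word n) :=
  if l is e :: ys then subproduct (flatten (nseq t ys)) e else Ret n (no_word n).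

Section Sampling.
Variables (R : realType) (n : nat) (gT : finGroupType) (G : {group gT}).
Variable B : black_box n G.
Implicit Types (u v e : word n) (xs ys l : seq (word n)).

Definition valid u : bool := decoding B u != None.

(** Decoding into [subg_of G] makes [G] a whole group type, as in the sections on cubes; words that
    are not codes go to 1. *)
Definition dec u : subg_of G := subg G (odflt 1%g (decoding B u)).

Lemma valid_mul u v : valid u -> valid v ->
  valid (oracle_mul B u v) /\ dec (oracle_mul B u v) = (dec u * dec v)%g.
Proof.
rewrite /valid /dec.
case Eu: (decoding B u) => [x|//] _; case Ev: (decoding B v) => [y|//] _.
rewrite (oracle_mulP Eu Ev) /=; split=> //.
by rewrite subgM //; apply: decoding_mem; eauto.
Qed.

Lemma valid_inv u : valid u ->
  valid (oracle_inv B u) /\ dec (oracle_inv B u) = (dec u)^-1%g.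
Proof.
rewrite /valid /dec; case Eu: (decoding B u) => [x|//] _.
rewrite (oracle_invP Eu) /=; split=> //.
by apply/val_inj; rewrite /= !subgK ?groupV //; apply: decoding_mem; eauto.
Qed.

Lemma always_subproduct xs u :
  all valid xs -> valid u -> always B (subproduct xs u) valid.
Proof.
elim: xs u => [|x xs IH] u //= /andP[vx vxs] vu; split; first exact: IH.
by apply: IH => //; case: (valid_mul vu vx).
Qed.

Lemma cost_subproduct xs u : (cost B (subproduct xs u) <= size xs)%N.
Proof.
elim: xs u => [|x xs IH] u //=.
by rewrite geq_max ltnS IH andbT (leq_trans (IH u)).
Qed.

Lemma expect_subproduct xs u (F : subg_of G -> R) :
  all valid xs -> valid u ->
  expect B (subproduct xs u) (fun w => F (dec w)) =
  \sum_g cube R (map dec xs) g * F (dec u * g)%g.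
Proof.
elim: xs u => [|x xs IH] u /=.
  move=> _ _; rewrite (bigD1 1%g) //= eqxx mul1r mulg1 big1 ?addr0 //.
  by move=> g /negbTE ->; rewrite mul0r.
move=> /andP[vx vxs] vu; have [vm dm] := valid_mul vu vx.
rewrite !IH // dm.
rewrite [RHS](eq_bigr (fun g => (cube R (map dec xs) g * F (dec u * g)%g +
  cube R (map dec xs) ((dec x)^-1 * g)%g * F (dec u * g)%g) / 2)); last first.
  by move=> g _; rewrite /half_shift; ring.
rewrite -mulr_suml big_split /=; congr ((_ + _) / _).
rewrite [RHS](reindex_inj (mulgI (dec x))); apply: eq_bigr => g _.
by rewrite mulKg mulgA.
Qed.

Lemma always_sample e xs :
  all valid xs -> valid e -> always B (sample e xs) valid.
Proof.
move=> vxs ve; have vs := always_subproduct vxs ve.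
apply/always_bind; apply: always_impl vs => u vu.
apply/always_bind; apply: always_impl (always_subproduct vxs ve) => v vv /=.
by case: (valid_inv vv) => vi _; case: (valid_mul vu vi).
Qed.

Lemma cost_sample e xs : all valid xs -> valid e ->
  (cost B (sample e xs) <= 2 * size xs + 2)%N.
Proof.
move=> vxs ve; have vs := always_subproduct vxs ve.
have c2 u : (cost B (bind (subproduct xs e) (fun v =>
    Defs.Inv v (fun v' => Mul u v' (@Ret n _)))) <= size xs + 2)%N.
  apply: leq_trans (cost_bind (c := 2) _) _; first by apply: always_impl vs.
  by rewrite leq_add2r cost_subproduct.
apply: leq_trans (cost_bind (c := size xs + 2) _) _.
  by apply: always_impl vs => u _; apply: c2.
by rewrite mul2n -addnn -addnA leq_add2r cost_subproduct.
Qed.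

Lemma expect_sample e xs (F : subg_of G -> R) :
  all valid xs -> valid e -> dec e = 1%g ->
  expect B (sample e xs) (fun w => F (dec w)) =
  \sum_x corr (cube R (map dec xs)) x * F x.
Proof.
move=> vxs ve e1; have vs := always_subproduct vxs ve.
set Z := cube R (map dec xs).
transitivity (expect B (subproduct xs e) (fun u =>
    \sum_h Z h * F (dec u * h^-1)%g)).
  rewrite expect_bind; apply: eq_expect; apply: always_impl vs => u vu.
  transitivity (expect B (subproduct xs e) (fun v => F (dec u * (dec v)^-1)%g)).
    rewrite expect_bind; apply: eq_expect.
    apply: always_impl (always_subproduct vxs ve) => v vv /=.
    by have [vi <-] := valid_inv vv; have [_ ->] := valid_mul vu vi.
  rewrite (@expect_subproduct xs e (fun g => F (dec u * g^-1)%g)) // e1.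
  by apply: eq_bigr => h _; rewrite mul1g.
rewrite (@expect_subproduct xs e (fun g => \sum_h Z h * F (g * h^-1)%g)) // e1.
under [LHS]eq_bigr do rewrite mul1g mulr_sumr.
rewrite exchange_big /= /corr.
under [RHS]eq_bigr do rewrite mulr_suml.
rewrite [RHS]exchange_big /=; apply: eq_bigr => h _.
(* Substituting [x * h] for the first factor turns the double sum into [corr]. *)
rewrite (reindex_inj (mulIg h)) /=; apply: eq_bigr => x _.
by rewrite mulgK mulrA.
Qed.

Lemma always_extend e xs l (E : seq (word n) -> Prop) :
  all valid xs -> valid e -> (forall x, valid x -> E (x :: l)) ->
  always B (extend e xs l) E.
Proof.
move=> vxs ve El; apply/always_bind.
by apply: always_impl (always_sample vxs ve) => x /El.
Qed.

Lemma cost_extend e xs l : all valid xs -> valid e ->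
  (cost B (extend e xs l) <= 2 * size xs + 2)%N.
Proof.
move=> vxs ve; apply: leq_trans (cost_bind (c := 0) _) _.
  by apply: always_impl (always_sample vxs ve).
by rewrite addn0 cost_sample.
Qed.

Lemma expect_extend e xs l (F : seq (subg_of G) -> R) :
  all valid xs -> valid e -> dec e = 1%g ->
  expect B (extend e xs l) (fun l' => F (map dec l')) =
  \sum_x corr (cube R (map dec xs)) x * F (x :: map dec l).
Proof.
move=> vxs ve e1; rewrite expect_bind /=.
by rewrite (@expect_sample e xs (fun x => F (x :: map dec l))).
Qed.

Section Build.
Variables (e : word n) (gens : seq (word n)) (k : nat).
Hypotheses (ve : valid e) (e1 : dec e = 1%g).
Hypotheses (vgens : all valid gens) (gen_gens : generating (map dec gens)).

(** The size equation bounds the cost of every round; generation is what the contraction of the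
    potential requires. *)
Definition growing i xs : Prop :=
  [/\ all valid xs, generating (map dec xs) & (size xs + i = size gens + k)%N].

Definition collecting i ys : Prop := all valid ys /\ (size ys + i = k)%N.

Lemma growing_extend i xs :
  growing i.+1 xs -> always B (extend e xs xs) (growing i).
Proof.
case=> vxs gxs sz; apply: always_extend => // x vx; split=> /=.
- by rewrite vx.
- exact: generating_cons.
- by rewrite addSnnS.
Qed.

Lemma collecting_extend xs i ys : all valid xs ->
  collecting i.+1 ys -> always B (extend e xs ys) (collecting i).
Proof.
move=> vxs [vys sz]; apply: always_extend => // x vx; split=> /=.
  by rewrite vx.
by rewrite addSnnS.
Qed.

Lemma growing_gens : growing k gens.
Proof. by split. Qed.

Lemma collecting_nil : collecting k [::].
Proof. by split. Qed.

Let grow := repeat k (fun xs => extend e xs xs) gens.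
Let collect xs := repeat k (extend e xs) [::].

Lemma always_grow : always B grow (growing 0).
Proof. exact: (always_repeat growing_extend growing_gens). Qed.

Lemma always_collect xs : all valid xs -> always B (collect xs) (collecting 0).
Proof.
move=> vxs.
exact: (always_repeat (fun i ys => @collecting_extend xs i ys vxs) collecting_nil).
Qed.

Lemma cost_grow : (cost B grow <= k * (2 * (size gens + k) + 2))%N.
Proof.
apply: (cost_repeat growing_extend) growing_gens => i xs [vxs _ sz].
apply: leq_trans (cost_extend _ vxs ve) _.
by rewrite leq_add2r leq_mul2l /= -sz leq_addr.
Qed.

Lemma cost_collect xs : all valid xs ->
  (cost B (collect xs) <= k * (2 * size xs + 2))%N.
Proof.
move=> vxs.
apply: (cost_repeat (fun i ys => @collecting_extend xs i ys vxs)) collecting_nil.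
by move=> i ys _; apply: cost_extend.
Qed.

Lemma expect_grow : expect B grow (fun xs => potential R (map dec xs)) <=
  rate R ^+ k.
Proof.
apply: (@le_trans _ _ (rate R ^+ k * potential R (map dec gens))).
  apply: (expect_repeat growing_extend) growing_gens; first exact: rate_ge0.
  move=> i xs [vxs gxs _].
  by rewrite expect_extend //; apply: potential_contract.
by rewrite ler_piMr ?potential_le1 // exprn_ge0 // rate_ge0.
Qed.

Lemma expect_collect xs : all valid xs -> flat (cube R (map dec xs)) ->
  expect B (collect xs) (fun ys => imbalance R (map dec ys)) <= (3 / 4) ^+ k.
Proof.
move=> vxs fl.
apply: (@le_trans _ _ ((3 / 4) ^+ k * imbalance R (map dec [::]))).
  apply: (expect_repeat (fun i ys => @collecting_extend xs i ys vxs)) collecting_nil.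
    lra.
  move=> i ys _; rewrite expect_extend //; exact: imbalance_contract.
by rewrite ler_piMr ?imbalance_nil // exprn_ge0 //; lra.
Qed.

End Build.
End Sampling.

(** * The algorithm *)

Section Correctness.
Variables (R : realType) (n : nat) (gT : finGroupType) (G : {group gT}).
Variable B : black_box n G.
Implicit Types (u v e : word n) (xs ys l gens : seq (word n)).

Lemma card_subg : #|subg_of G| = #|G|.
Proof. by rewrite (card_isog (isog_subg G)) cardsT. Qed.

Lemma law_subproduct xs e (g : gT) :
  all (valid B) xs -> valid B e -> dec B e = 1%g -> g \in G ->
  law R B (subproduct xs e) g = cube R (map (dec B) xs) (subg G g).
Proof.
move=> vxs ve e1 gG; rewrite /law Pr_expect.
transitivity (expect B (subproduct xs e)
    (fun w => (dec B w == subg G g)%:R : R)).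
  apply: eq_expect; apply: always_impl (always_subproduct vxs ve) => w.
  rewrite /valid /dec; case Ew: (decoding B w) => [x|//] _ /=; congr (_%:R).
  rewrite -(inj_eq val_inj) /= !subgK //; exact: decoding_mem Ew.
rewrite (@expect_subproduct _ _ _ _ _ _ _ (fun x => (x == subg G g)%:R : R)) // e1.
rewrite (bigD1 (subg G g)) //= mul1g eqxx mulr1 big1 ?addr0 // => h /negbTE.
by rewrite mul1g => ->; rewrite mulr0.
Qed.

Lemma all_flatten_nseq t ys :
  all (valid B) ys -> all (valid B) (flatten (nseq t ys)).
Proof. by move=> vys; elim: t => //= t IH; rewrite all_cat vys. Qed.

Lemma size_flatten_nseq (A : Type) t (s : seq A) :
  size (flatten (nseq t s)) = (t * size s)%N.
Proof. by elim: t => //= t IH; rewrite size_cat IH mulSn. Qed.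

Lemma draw_cubes_uniform t ys e (eps : R) :
  all (valid B) ys -> valid B e -> dec B e = 1%g ->
  (1 / 2) ^+ t.+1 <= eps ->
  imbalance R (map (dec B) ys) <= (1 / 2 / #|G|%:R) ^+ 2 ->
  eps_uniform G eps (law R B (draw_cubes t.+1 (e :: ys))).
Proof.
move=> vys ve e1 t_eps small; apply/forall_inP => g gG.
have -> : law R B (draw_cubes t.+1 (e :: ys)) g =
    cube R (map (dec B) (flatten (nseq t.+1 ys))) (subg G g).
  by apply: law_subproduct => //; apply: all_flatten_nseq.
rewrite map_flatten map_nseq -card_subg.
apply: le_trans (@cube_uniform_rep _ _ (1 / 2) _ _ _ (subg G g)) _.
  by apply: imbalance_small; rewrite ?card_subg //; apply: divr_ge0.
by rewrite ler_wpM2r // invr_ge0.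
Qed.

Lemma generating_subg gens (S : {set gT}) : <<S>>%g = G ->
  perm_eq [seq decoding B u | u <- gens] [seq Some x | x <- enum S] ->
  generating (map (dec B) gens).
Proof.
move=> genS permS H allH; apply/eqP; rewrite finset.eqEsubset finset.subsetT /=.
suff sub : G \subset (sgval @* H)%g.
  apply/fintype.subsetP => x _.
  have /(fintype.subsetP sub)/morphimP[y _ yH eq_xy] := subgP x.
  by rewrite (subg_inj eq_xy).
rewrite -genS gen_subG; apply/fintype.subsetP => x xS.
have : Some x \in [seq Some x | x <- enum S].
  by apply/mapP; exists x; rewrite ?mem_enum.
rewrite -(perm_mem permS) => /mapP[u u_gens dec_u].
apply/morphimP; exists (dec B u); rewrite ?inE //.
  by have /allP/(_ (dec B u)) := allH; apply; apply: map_f.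
rewrite /dec -dec_u /= subgK //; exact: decoding_mem (esym dec_u).
Qed.

Lemma valid_gens gens (S : {set gT}) :
  perm_eq [seq decoding B u | u <- gens] [seq Some x | x <- enum S] ->
  all (valid B) gens.
Proof.
move=> permS; apply/allP => u /(map_f (decoding B)).
by rewrite (perm_mem permS) => /mapP[x _]; rewrite /valid => ->.
Qed.

(** * Failure probability and cost of the construction *)

Variables (gens : seq (word n)) (k : nat).
Hypotheses (vgens : all (valid B) gens) (gens0 : gens != [::]).
Hypothesis gen_gens : generating (map (dec B) gens).

Definition failure t (eps : R) l : bool :=
  ~~ eps_uniform G eps (law R B (draw_cubes t l)).

(** Markov again: a failure forces the imbalance above [(1 / 2 / #|G|) ^+ 2], which the factor
    [4 * #|G| ^+ 2] scales to 1. *)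
Lemma failure_collect t (eps : R) e ys :
  all (valid B) ys -> valid B e -> dec B e = 1%g ->
  (1 / 2) ^+ t.+1 <= eps ->
  (failure t.+1 eps (e :: ys))%:R <=
    4 * #|G|%:R ^+ 2 * imbalance R (map (dec B) ys).
Proof.
move=> vys ve e1 t_eps; rewrite /failure.
have N0 : 0 < #|G|%:R :> R by rewrite ltr0n cardG_gt0.
have I0 := imbalance_ge0 R (map (dec B) ys).
have [small|big] := leP (imbalance R (map (dec B) ys)) ((1 / 2 / #|G|%:R) ^+ 2).
  by rewrite draw_cubes_uniform //= mulr_ge0 // mulr_ge0 // exprn_ge0.
apply: (@le_trans _ _ (4 * #|G|%:R ^+ 2 * (1 / 2 / #|G|%:R) ^+ 2)).
  have -> : 4 * #|G|%:R ^+ 2 * (1 / 2 / #|G|%:R) ^+ 2 = 1 :> R.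
    by field; apply: lt0r_neq0.
  by case: (~~ _).
by apply: ler_wpM2l (ltW big); rewrite mulr_ge0 // exprn_ge0 // ltW.
Qed.

Lemma find_one u : valid B u ->
  let e := oracle_mul B u (oracle_inv B u) in valid B e /\ dec B e = 1%g.
Proof.
move=> vu; have [vi di] := valid_inv vu; have [vm dm] := valid_mul vu vi.
by rewrite /= dm di mulgV.
Qed.

(** Missing flatness contributes [#|G| * rate ^+ k], and the second phase from a flat law
    [4 * #|G| ^+ 2 * (3 / 4) ^+ k]; hence the coefficient 1 + 4. *)
Lemma expect_failure t (eps : R) : (1 / 2) ^+ t.+1 <= eps ->
  expect B (build k gens) (fun l => (failure t.+1 eps l)%:R) <=
  5 * #|G|%:R ^+ 2 * rate R ^+ k.
Proof.
move=> t_eps; case def_gens: gens gens0 => [//|u gens'] _ /=; rewrite -def_gens.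
have vu : valid B u by move: vgens; rewrite def_gens => /andP[].
have [ve e1] := find_one vu; set e := oracle_mul _ _ _ in ve e1 *.
have N1 : 1 <= #|G|%:R :> R by rewrite ler1n cardG_gt0.
have c34 : (3 / 4) ^+ k <= rate R ^+ k.
  by rewrite lerXn2r ?nnegrE ?rate_ge0 //; have := rate_bounds R; lra.
have ck0 : 0 <= rate R ^+ k by rewrite exprn_ge0 // rate_ge0.
rewrite expect_bind.
apply: (@le_trans _ _
    (#|G|%:R * rate R ^+ k + 4 * #|G|%:R ^+ 2 * rate R ^+ k)); last first.
  have : #|G|%:R <= #|G|%:R ^+ 2 :> R by rewrite expr2 ler_peMr //; lra.
  move: (#|G|%:R) (rate R ^+ k) ck0 => N q q0 /(ler_wpM2r q0); lra.
apply: (@le_trans _ _ (expect B (repeat k (fun xs => extend e xs xs) gens)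
    (fun xs => #|G|%:R * potential R (map (dec B) xs)
               + 4 * #|G|%:R ^+ 2 * rate R ^+ k))); last first.
  rewrite expectDr expectZ lerD2r ler_wpM2l ?ler0n //.
  exact: expect_grow.
apply: expect_le.
apply: always_impl (always_grow k ve vgens gen_gens) => xs [vxs gxs _].
have nflat := not_flat_le_potential R (map (dec B) xs).
rewrite card_subg in nflat; apply: le_trans (_ : _ <= _) (lerD nflat (lexx _)).
rewrite expect_bind /=.
have vcol := always_collect k ve vxs.
have [fl|_] /= := boolP (flat _); last first.
  apply: (@le_trans _ _ 1); last first.
    by rewrite lerDl mulr_ge0 // mulr_ge0 // exprn_ge0.
  rewrite -[leRHS](expect_cst B (repeat k (extend e xs) [::])).
  apply: expect_le; apply: always_impl vcol => ys _.
  by case: (failure _ _ _).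
rewrite add0r; apply: (@le_trans _ _ (4 * #|G|%:R ^+ 2 *
    expect B (repeat k (extend e xs) [::])
      (fun ys => imbalance R (map (dec B) ys)))).
  rewrite -expectZ; apply: expect_le; apply: always_impl vcol => ys [vys _].
  exact: failure_collect.
apply: ler_wpM2l; first by rewrite mulr_ge0 // exprn_ge0 // ltW.
by apply: le_trans c34; apply: expect_collect.
Qed.

Lemma always_build : always B (build k gens) (fun l =>
  [/\ l != [::], all (valid B) l & size l = k.+1]).
Proof.
case def_gens: gens gens0 => [//|u gens'] _ /=; rewrite -def_gens.
have vu : valid B u by move: vgens; rewrite def_gens => /andP[].
have [ve e1] := find_one vu.
apply/always_bind.
apply: always_impl (always_grow k ve vgens gen_gens) => xs [vxs _ _].
apply/always_bind; apply: always_impl (always_collect k ve vxs) => ys [vys sz] /=.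
by split; rewrite ?ve //= -sz addn0.
Qed.

Lemma cost_build :
  (cost B (build k gens) <= 2 + 2 * (k * (2 * (size gens + k) + 2)))%N.
Proof.
have [m def_m] : exists m, m = (k * (2 * (size gens + k) + 2))%N by eexists.
rewrite -def_m; case def_gens: gens gens0 => [//|u gens'] _ /=; rewrite -def_gens.
have vu : valid B u by move: vgens; rewrite def_gens => /andP[].
have [ve e1] := find_one vu; rewrite !ltnS.
apply: leq_trans (cost_bind (c := m) _) _; last first.
  by rewrite mul2n -addnn leq_add2r def_m; apply: cost_grow.
apply: always_impl (always_grow k ve vgens gen_gens) => xs [vxs _ sz].
apply: leq_trans (cost_bind (c := 0) _) _.
  by apply: always_impl (always_collect k ve vxs).
rewrite addn0 def_m -sz addn0; exact: cost_collect.
Qed.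

Lemma always_draw t l : all (valid B) l -> l != [::] ->
  always B (draw_cubes t l) (valid B).
Proof.
case: l => [//|e ys] /= /andP[ve vys] _.
by apply: always_subproduct; rewrite ?all_flatten_nseq.
Qed.

Lemma cost_draw t l : (cost B (draw_cubes t l) <= t * (size l).-1)%N.
Proof.
case: l => [//|e ys] /=; apply: leq_trans (cost_subproduct _ _ _) _.
by rewrite size_flatten_nseq.
Qed.

End Correctness.

(** * Rounded logarithms and numerical bounds *)

Section Logarithm.
Variable R : realType.

(** For [1 <= r] it is the floor of the binary logarithm plus one; this exceeds the ceiling at
    powers of 2 but is always positive. *)
Definition log2_ceil (r : R) : nat := (Num.trunc (ln r / ln 2)).+1.

Lemma ln2_gt0 : 0 < ln 2 :> R.
Proof. by rewrite ln_gt0 // ltr1n. Qed.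

Lemma le_exp2_log2_ceil (r : R) : 0 < r -> r <= 2 ^+ log2_ceil r.
Proof.
move=> r0; rewrite -ler_ln ?posrE ?exprn_gt0 // lnXn // -[leRHS]mulr_natl.
rewrite -ler_pdivrMr ?ln2_gt0 // ltW //.
by rewrite -[_ < _]truncn_le_nat.
Qed.

(** For [2 <= r] the binary logarithm is at least 1, so doubling it absorbs the added one. *)
Lemma log2_ceil_le (r : R) : 2 <= r -> (log2_ceil r)%:R <= 2 / ln 2 * ln r.
Proof.
move=> r2; have l2 := ln2_gt0.
have q1 : 1 <= ln r / ln 2.
  by rewrite ler_pdivlMr // mul1r ler_ln ?posrE //; lra.
have : (Num.trunc (ln r / ln 2))%:R <= ln r / ln 2 by rewrite truncn_le; lra.
rewrite /log2_ceil -natr1 (_ : 2 / ln 2 * ln r = 2 * (ln r / ln 2)); lra.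
Qed.

End Logarithm.

Lemma exists_small_power (R : realType) (c d : R) :
  0 <= c < 1 -> 0 < d -> exists K : nat, c ^+ K < d.
Proof.
case/andP=> c0 c1 d0.
have := @cvg_expr R c; rewrite ger0_norm // => /(_ c1) cvg_c.
have [K _ /(_ K (leqnn K)) /=] := cvgr0_norm_lt _ cvg_c d d0.
by rewrite ger0_norm ?exprn_ge0 // => ?; exists K.
Qed.

Section Algorithm.
Variables (R : realType) (K : nat).

(* If the bound on the order is 1 then no group operation is affordable, but
   any generator is the identity. *)
Definition random_cubes : sampling_algorithm R :=
  @SamplingAlgorithm R
    (fun eps L order n gens =>
       let M := odflt L order in
       if (M <= 1)%N then Ret n gens
       else build (K * log2_ceil (M%:R : R)) gens)
    (fun eps L order n l =>
       let M := odflt L order in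
       if (M <= 1)%N then Ret n (head (no_word n) l)
       else draw_cubes (log2_ceil (1 / eps)) l).

Lemma trivial_uniform (n : nat) (gT : finGroupType) (G : {group gT})
    (B : black_box n G) (eps : R) l :
  (#|G| <= 1)%N -> 0 < eps -> all (valid B) l -> l != [::] ->
  eps_uniform G eps (law R B (Ret n (head (no_word n) l))).
Proof.
move=> G1 eps0; case: l => [//|e l] /= /andP[ve _] _.
have triv := card_le1_trivg G1.
apply/forall_inP => g; rewrite triv => /set1P ->.
rewrite cards1 /law /=; move: ve; rewrite /valid.
case Ee: (decoding B e) => [x|//] _.
have := decoding_mem Ee; rewrite triv => /set1P ->.
by rewrite eqxx divr1 subrr normr0 divr1 ltW.
Qed.

End Algorithm.

Lemma ln2_lt2 (R : realType) : ln 2 < 2 :> R.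
Proof. by have := @le_ln1Dx R 1; rewrite -[1 + 1]/2; lra. Qed.

(** [N ^+ 2 <= 4 ^+ m] and [c ^+ (K * m) <= d ^+ m], so their product is at most [(4 * d) ^+ m],
    hence at most [4 * d]. *)
Lemma failure_bound (R : realType) (c d N : R) (K m : nat) :
  0 <= c -> c ^+ K < d -> 4 * d <= 1 -> 0 <= N <= 2 ^+ m -> (0 < m)%N ->
  5 * N ^+ 2 * c ^+ (K * m) <= 20 * d.
Proof.
move=> c0 small d1 /andP[N0 Nm] m0.
have d0 : 0 <= d by apply: le_trans (ltW small); rewrite exprn_ge0.
rewrite (_ : 20 * d = 5 * (4 * d)); last by ring.
rewrite -mulrA ler_wpM2l // exprM.
apply: (@le_trans _ _ ((2 ^+ m) ^+ 2 * d ^+ m)).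
  apply: ler_pM; rewrite ?exprn_ge0 // lerXn2r ?nnegrE ?exprn_ge0 //.
  exact: ltW.
rewrite -exprM mulnC exprM -exprMn (_ : 2 ^+ 2 = 4); last by ring.
by apply: ler_iXnr => //; apply: mulr_ge0.
Qed.

(** Here [l] is the rounded logarithm, [y] the natural one and [s] the number of generators.
    [1 <= l] absorbs the lower-order terms, and [1 <= a] allows [a ^+ 2] on the mixed term. *)
Lemma build_cost_bound (R : realType) (k l s y a : R) :
  0 <= k -> 1 <= l -> 0 <= s -> 1 <= a -> l <= a * y ->
  2 + 2 * (k * l * (2 * (s + k * l) + 2)) <=
  (4 * k ^+ 2 + 4 * k + 2) * a ^+ 2 * (y ^+ 2 + s * y).
Proof.
move=> k0 l1 s0 a1 ly.
have y0 : 0 <= y by nra.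
apply: (@le_trans _ _ ((4 * k ^+ 2 + 4 * k + 2) * (l ^+ 2 + s * l))).
  have ll : 0 <= l ^+ 2 - l by nra.
  have kll := mulr_ge0 k0 ll.
  have sl : 0 <= s * l by nra.
  have ksl : 0 <= k ^+ 2 * (s * l) by rewrite mulr_ge0 ?exprn_ge0.
  nra.
rewrite -mulrA ler_wpM2l //; first by nra.
rewrite mulrDr lerD //; first by rewrite -exprMn lerXn2r ?nnegrE //; lra.
rewrite mulrCA ler_wpM2l // expr2 -mulrA; nra.
Qed.

Lemma draw_cost_bound (R : realType) (k l m y z a : R) :
  0 <= k -> 0 <= l <= a * y -> 0 <= m <= a * z ->
  m * (k * l) <= (4 * k ^+ 2 + 4 * k + 2) * a ^+ 2 * (z * y).
Proof.
move=> k0 /andP[l0 ly] /andP[m0 mz].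
apply: (@le_trans _ _ (k * ((a * z) * (a * y)))).
  by rewrite mulrCA ler_wpM2l // ler_pM.
rewrite (_ : _ * a ^+ 2 * _ = (4 * k ^+ 2 + 4 * k + 2) * ((a * z) * (a * y))).
  by rewrite ler_wpM2r //; [rewrite mulr_ge0; lra|nra].
by ring.
Qed.

Theorem theorem7p3 (R : realType) (delta : R) (delta_gt0 : 0 < delta) :
  exists (alg : sampling_algorithm R) (C : R),
  forall (eps : R) (L n : nat) (gT : finGroupType) (G : {group gT})
    (B : black_box n G) (S : {set gT}) (gens : seq (word n))
    (order : option nat),
  0 < eps <= 1 / 2 ->
  <<S>>%g = G ->
  S != finset.set0 ->
  (* [gens] lists one code for each element of [S] *)
  perm_eq [seq decoding B u | u <- gens] [seq Some x | x <- enum S] ->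
  (#|G| < L)%N ->
  order = None \/ order = Some #|G| ->
  let M : nat := odflt L order in
  let build := construct alg eps L order gens in
  let X := fun l : seq (word n) => draw alg eps L order l in
  [/\ 1 - delta <= Pr B R build (fun l => eps_uniform G eps (law R B (X l))),
      (cost B build)%:R <= C * (ln M%:R ^+ 2 + #|S|%:R * ln M%:R :> R)
    & always B build (fun l =>
        [/\ all (fun u => decoding B u != None) l,
            always B (X l) (fun w => decoding B w != None)
          & (cost B (X l))%:R <= C * (ln (1 / eps) * ln M%:R)])].
Proof.
(* The failure bound will be [20 * d], and [4 * d <= 1] is needed as well. The resulting [K] depends
   on [delta] only. *)
pose d := Num.min delta 1 / 20.
have d0 : 0 < d by rewrite divr_gt0 // lt_min delta_gt0 ltr01.
have d_delta : 20 * d <= delta.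
  by rewrite /d mulrC divfK ?pnatr_eq0 // ge_min lexx.
have d_1 : 20 * d <= 1.
  by rewrite /d mulrC divfK ?pnatr_eq0 // ge_min lexx orbT.
have d_4 : 4 * d <= 1 by lra.
have [||K small] := @exists_small_power R (rate R) d; [|done|].
  by have := rate_bounds R; lra.
pose a : R := 2 / ln 2.
have a0 : 0 < a by rewrite divr_gt0 ?ln2_gt0.
exists (random_cubes R K), ((4 * K%:R ^+ 2 + 4 * K%:R + 2) * a ^+ 2).
move=> eps L n gT G B S gens order /andP[eps0 eps2] genS S0 permS ltGL ord M.
have vgens := valid_gens permS.
have size_gens : size gens = #|S|.
  by rewrite cardE -(size_map (decoding B)) (perm_size permS) size_map.
have gens0 : gens != [::] by rewrite -size_eq0 size_gens cards_eq0.
have leGM : (#|G| <= M)%N by rewrite /M; case: ord => -> //=; apply: ltnW.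
move=> bld X; rewrite /bld /X /= -/M.
(* For [M = 1] the logarithm vanishes and no oracle call is allowed; [2 <= M] is what [log2_ceil_le]
   asks for. *)
have [M1|M2] := leqP M 1.
  have lnM : ln M%:R = 0 :> R.
    suff -> : M = 1%N by rewrite ln1.
    by apply/eqP; rewrite eqn_leq M1 (leq_trans (cardG_gt0 G) leGM).
  rewrite lnM expr0n !mulr0 add0r mulr0 /=.
  have uni := trivial_uniform (leq_trans leGM M1) eps0 vgens gens0.
  rewrite uni lexx; split=> //; first by rewrite lerBlDr lerDl ltW.
  split=> //; move: gens0 vgens; case: (gens) => [//|u l] /=.
  by move=> _ /andP[].
have gen_gens := generating_subg genS permS.
set lam := log2_ceil _; set t := log2_ceil _.
have lam_le : lam%:R <= a * ln M%:R by apply: log2_ceil_le; rewrite ler_nat.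
have t_le : t%:R <= a * ln (1 / eps).
  by apply: log2_ceil_le; rewrite ler_pdivlMr //; lra.
have t_eps : (1 / 2) ^+ t <= eps.
  have : 1 / eps <= 2 ^+ t by apply: le_exp2_log2_ceil; rewrite divr_gt0.
  by rewrite !div1r exprVn -lef_pV2 ?posrE ?invr_gt0 ?exprn_gt0 // invrK.
have lamM : M%:R <= 2 ^+ lam :> R by apply: le_exp2_log2_ceil; rewrite ltr0n ltnW.
have lam1 : 1 <= lam%:R :> R by rewrite ler1n.
have costs := cost_build (K * lam) vgens gens0 gen_gens.
split.
- rewrite Pr_expect.
  have fail := expect_failure (K * lam) vgens gens0 gen_gens t_eps.
  have fail_delta : 5 * #|G|%:R ^+ 2 * rate R ^+ (K * lam) <= delta.
    apply: le_trans d_delta; apply: failure_bound => //; first exact: rate_ge0.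
    by rewrite ler0n (le_trans _ lamM) // ler_nat.
  apply: (@le_trans _ _ (- (expect B (build (K * lam) gens)
      (fun l => (failure B t eps l)%:R)) + 1)).
    by rewrite [leRHS]addrC lerD2l lerN2; apply: le_trans fail fail_delta.
  rewrite -mulN1r -expectZ -expectDr; apply: expect_le.
  apply: always_impl (always_build (K * lam) vgens gens0 gen_gens) => l _.
  by rewrite /failure; case: eps_uniform; rewrite /= ?mulr0 ?add0r ?mulr1 ?addNr.
- have : (cost B (build (K * lam) gens))%:R <=
      2 + 2 * (K%:R * lam%:R * (2 * (#|S|%:R + K%:R * lam%:R) + 2)) :> R.
    by rewrite -size_gens -!(natrM, natrD) ler_nat.
  move/le_trans; apply.
  have a1 : 1 <= a.
    by rewrite ler_pdivlMr ?ln2_gt0 // mul1r ltW // ln2_lt2.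
  by apply: build_cost_bound; rewrite ?ler0n.
- apply: always_impl (always_build (K * lam) vgens gens0 gen_gens).
  move=> l [l0 vl sz]; split=> //; first exact: always_draw.
  apply: (@le_trans _ _ (t%:R * (K%:R * lam%:R))).
    by rewrite -!natrM ler_nat; have := cost_draw B t l; rewrite sz.
  by apply: draw_cost_bound; rewrite ?lam_le ?t_le ?ler0n.
Qed.
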